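(* Let $G$ be a connected graph of order $n$ with matching number $k$, where either $k\ge 2$, or $k=1$ and $n\ge 20$. Then $$\rho(G)+k\ \ge\ 3\sqrt[3]{\frac{n}{4}}.$$ Moreover, this bound is tight up to a constant factor: there exist a constant $C>0$ and a sequence of connected graphs $(G_m)_{m\ge 1}$, with $G_m$ of order $n_m$ and matching number $k_m$ and $n_m\to\infty$, such that $\rho(G_m)+k_m\le C\,n_m^{1/3}$ for all $m$ (so that $\rho(G_m)+k_m=\Theta(n_m^{1/3})$).
   Context: Graphs are finite, simple and undirected. The order of a graph is its number of vertices; the matching number is the size of a maximum matching; $\rho(G)$ denotes the spectral radius of $G$, i.e. the largest eigenvalue of its adjacency matrix. *)

(* Defs.v *)
From HB Require Import structures.
From mathcomp Require Import all_boot all_order all_algebra.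
From mathcomp Require Import all_classical all_reals all_analysis.
Set Implicit Arguments.
Unset Strict Implicit.
Unset Printing Implicit Defensive.
Import Order.TTheory GRing.Theory Num.Theory.
Import numFieldNormedType.Exports.
Local Open Scope ring_scope.

Record sgraph := SGraph {
  vertex :> finType;
  edge : rel vertex;
  edge_sym : symmetric edge;
  edge_irrefl : irreflexive edge }.

(* The graph with no vertex is not regarded as connected. *)
Definition connected_graph (G : sgraph) : Prop :=
  (0 < #|G|)%N /\ forall x y : G, connect (@edge G) x y.

Definition edge_set (G : sgraph) : {set {set G}} :=
  [set e : {set G} | [exists x, exists y, edge x y && (e == [set x; y])]]%SET.

Definition is_matching (G : sgraph) (M : {set {set G}}) : bool :=
  (M \subset edge_set G) && finset.trivIset M.

Definition matching_number (G : sgraph) : nat :=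
  \max_(M : {set {set G}} | is_matching M) #|M|.

Definition adjacency_mx (R : pzSemiRingType) (G : sgraph) : 'M[R]_#|G| :=
  \matrix_(i, j) (edge (enum_val i) (enum_val j))%:R.

(* The adjacency matrix is real symmetric, so for a nonempty graph its real
   eigenvalues form a finite nonempty set, whose supremum is the largest
   eigenvalue. *)
Definition spectral_radius (R : realType) (G : sgraph) : R :=
  sup [set a : R | eigenvalue (adjacency_mx R G) a]%classic.

(* Main.v *)
Require Import Defs.
From mathcomp Require Import all_boot all_order all_algebra.
From mathcomp Require Import all_classical all_reals all_analysis.
From mathcomp Require Import ring lra zify.
Set Implicit Arguments.
Unset Strict Implicit.
Unset Printing Implicit Defensive.
Import Order.TTheory GRing.Theory Num.Theory.
Import numFieldNormedType.Exports.
Local Open Scope classical_set_scope.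
Local Open Scope ring_scope.

(** Write rho for the spectral radius, k for the matching number and n for the
order. The lower bound follows from rho^2 k >= n: by the inequality between
the arithmetic and geometric means applied to rho/2, rho/2 and k,
(rho + k)^3 >= 27 rho^2 k / 4 >= 27 n / 4 ([amgm_cube]).

To bound rho from below, test the adjacency matrix A on the indicator x of a
set S of vertices. Since A is symmetric and nonnegative, its largest eigenvalue
is also its operator norm ([eigenvalue_dominates]), hence rho^2 |S| >= |xA|^2,
and |xA|^2 is the sum over all vertices v of d(v)^2, where d(v) is the number
of neighbours of v in S.

The set S is a vertex cover of a spanning tree, no larger than the matching
number. König's theorem would provide it; for a rooted tree it is explicit: S
consists of the vertices with a child outside S, and matching every vertex of S
with such a child gives |S| disjoint edges ([spanning_tree_cover]). The n - 1
tree edges all touch S, which bounds d from below: d^2 >= 2d - 1 outside S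
and d^2 >= d inside S, and the sum of 2d outside S and d inside S counts every
edge touching S twice, so the sum of the d^2 is at least 2(n - 1) - (n - |S|)
([degrees_into_tree_cover]). Therefore rho^2 s >= n + s - 2 for some s with
1 <= s <= k ([spectral_radius_matching]). If k >= 2 this gives rho^2 k >= n;
if k = 1 it gives rho^2 >= n - 1, which is enough when n >= 20.

For the tightness take M stars with M^2 - 1 leaves each and join their centres
into a clique. The order is M^3, the centres cover all edges, so that k <= M,
and weighting centres by M and leaves by 1 shows rho <= 2M
([spectral_radius_star_clique]). *)

(** * The largest eigenvalue of a symmetric nonnegative matrix *)

Definition dot (R : comNzRingType) n (u v : 'rV[R]_n) : R := (u *m v^T) 0 0.

Lemma dotE (R : comNzRingType) n (u v : 'rV[R]_n) :
  dot u v = \sum_i u 0 i * v 0 i.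
Proof. by rewrite /dot mxE; apply: eq_bigr => i _; rewrite mxE. Qed.

Lemma dotC (R : comNzRingType) n (u v : 'rV[R]_n) : dot u v = dot v u.
Proof. by rewrite !dotE; apply: eq_bigr => i _; rewrite mulrC. Qed.

Lemma dotDl (R : comNzRingType) n (u v w : 'rV[R]_n) :
  dot (u + v) w = dot u w + dot v w.
Proof. by rewrite /dot mulmxDl mxE. Qed.

Lemma dotDr (R : comNzRingType) n (u v w : 'rV[R]_n) :
  dot w (u + v) = dot w u + dot w v.
Proof. by rewrite dotC dotDl ![dot _ w]dotC. Qed.

Lemma dotZl (R : comNzRingType) n a (u v : 'rV[R]_n) :
  dot (a *: u) v = a * dot u v.
Proof. by rewrite /dot -scalemxAl mxE. Qed.

Lemma dotZr (R : comNzRingType) n a (u v : 'rV[R]_n) :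
  dot u (a *: v) = a * dot u v.
Proof. by rewrite dotC dotZl dotC. Qed.

Lemma dot_ge0 (R : realDomainType) n (u : 'rV[R]_n) : 0 <= dot u u.
Proof. by rewrite dotE sumr_ge0 // => i _; rewrite -expr2 sqr_ge0. Qed.

Lemma dot_eq0 (R : realDomainType) n (u : 'rV[R]_n) : dot u u = 0 -> u = 0.
Proof.
rewrite dotE => /eqP; rewrite psumr_eq0 => [/allP u0|i _]; last first.
  by rewrite -expr2 sqr_ge0.
apply/rowP => i; rewrite mxE; have := u0 i (mem_index_enum i).
by rewrite /= mulf_eq0 orbb => /eqP.
Qed.

Lemma dot_sym (R : comNzRingType) n (A : 'M[R]_n) (u v : 'rV[R]_n) :
  A^T = A -> dot (u *m A) v = dot u (v *m A).
Proof. by move=> symA; rewrite /dot trmx_mul symA mulmxA. Qed.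

Lemma continuous_sum (R : realType) (T : topologicalType) (I : finType)
    (F : I -> T -> R) :
  (forall i, continuous (F i)) -> continuous (fun x => \sum_i F i x : R).
Proof.
move=> cF x; rewrite /continuous_at; elim: (index_enum I) => [|i r IH].
  rewrite big_nil (_ : (fun y => \sum_(i <- [::]) F i y) = cst 0).
    exact: cvg_cst.
  by apply/funext => y; rewrite big_nil.
rewrite big_cons (_ : (fun y => _) = F i \+ (fun y => \sum_(j <- r) F j y)).
  by apply: cvgD => //; exact: cF.
by apply/funext => y /=; rewrite big_cons.
Qed.

Lemma continuous_quadratic (R : realType) n (A : 'M[R]_n) :
  continuous (fun y : 'rV[R]_n => dot (y *m A) y).
Proof.
rewrite (_ : (fun _ => _) =
  fun y : 'rV[R]_n => \sum_i (\sum_j (y 0 j * A j i)) * y 0 i); last first.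
  by apply/funext => y; rewrite dotE; apply: eq_bigr => i _; rewrite mxE.
have cA i : continuous (fun y : 'rV[R]_n => \sum_j (y 0 j * A j i) : R).
  apply: (continuous_sum (F := fun j (y : 'rV[R]_n) => y 0 j * A j i)) => j x.
  apply: continuousM; last exact: cst_continuous.
  exact: (@coord_continuous R 1 n 0 j).
apply: (continuous_sum (F := fun i (y : 'rV[R]_n) =>
  (\sum_j (y 0 j * A j i)) * y 0 i)) => i x.
by apply: continuousM; [exact: cA|exact: (@coord_continuous R 1 n 0 i)].
Qed.

Lemma compact_unit_sphere (R : realType) n :
  compact [set y : 'rV[R]_n | dot y y = 1].
Proof.
apply: bounded_closed_compact.
  exists 1; split; first exact: num_real.
  move=> M ltM y /= y1; apply: le_trans (ltW ltM).
  rewrite [leLHS]/Num.norm /= mx_normrE; apply/bigmax_leP.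
  split => // -[i j] _ /=.
  rewrite ord1 -(@ler_pXn2r _ 2) ?nnegrE // expr1n real_normK ?num_real //.
  rewrite -y1 dotE (bigD1 j) //= -expr2 lerDl sumr_ge0 // => k _.
  by rewrite -expr2 sqr_ge0.
rewrite (_ : mkset _ = (fun y : 'rV[R]_n => dot (y *m 1%:M) y) @^-1` [set 1]).
  apply: preimage_closed; last exact: closed_eq.
  by move=> y _; exact: continuous_quadratic.
by apply/seteqP; split => y /=; rewrite mulmx1.
Qed.

(** The quadratic form is continuous, so it has a maximum on the compact unit
sphere; homogeneity extends the comparison from the sphere to all vectors. *)
Lemma quadratic_max (R : realType) n (A : 'M[R]_n) : (0 < n)%N ->
  exists2 y, dot y y = 1 &
    forall z, dot (z *m A) z <= dot (y *m A) y * dot z z.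
Proof.
move=> n0; pose e := delta_mx 0 (Ordinal n0) : 'rV[R]_n.
have e1 : dot e e = 1.
  rewrite dotE (bigD1 (Ordinal n0)) //= big1 => [|i /negPf ne].
    by rewrite !mxE !eqxx mulr1 addr0.
  by rewrite !mxE ne andbF mulr0.
have [|y] := EVT_max_rV _ (@compact_unit_sphere R n)
  (continuous_subspaceT (@continuous_quadratic R n A)).
  by exists e.
rewrite inE /= => y1 ymax; exists y => // z.
have [/dot_eq0 ->|z0] := eqVneq (dot z z) 0.
  by rewrite mul0mx /dot mul0mx mxE mulr0.
have zgt0 : 0 < dot z z by rewrite lt_def z0 dot_ge0.
pose s := Num.sqrt (dot z z).
have s2 : s ^+ 2 = dot z z by rewrite sqr_sqrtr // ltW.
have s0 : s != 0 by rewrite sqrtr_eq0 -ltNge.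
have := ymax (s^-1 *: z); rewrite inE /= -scalemxAl !dotZl !dotZr.
rewrite mulrA -invfM -expr2 s2 mulVf // => /(_ erefl).
by rewrite mulrA -invfM -expr2 s2 ler_pdivrMl // mulrC.
Qed.

(** With [lam] the maximal value and [g = yA - lam y], perturbing [y] to
[y + tg] changes [lam |z|^2 - zAz] by [- 2t |g|^2] to first order. This form is
nonnegative and vanishes at [y], so [g] must vanish. *)
Lemma quadratic_max_eigen (R : realFieldType) n (A : 'M[R]_n) (y : 'rV[R]_n) :
  A^T = A -> dot y y = 1 ->
  (forall z, dot (z *m A) z <= dot (y *m A) y * dot z z) ->
  y *m A = dot (y *m A) y *: y.
Proof.
move=> symA y1 ymax; set lam := dot (y *m A) y in ymax *.
pose g := y *m A - lam *: y.
have yA : y *m A = lam *: y + g by rewrite /g addrC subrK.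
apply/eqP; rewrite -subr_eq0 -/g; apply/eqP/dot_eq0.
clearbody g.
pose K := lam * dot g g - dot (g *m A) g.
have K0 : 0 <= K by rewrite subr_ge0 ymax.
have yg : dot (y *m A) g = lam * dot y g + dot g g.
  by rewrite yA dotDl dotZl.
have key t : 2 * t * dot g g <= t ^+ 2 * K.
  have := ymax (y + t *: g).
  rewrite mulmxDl -scalemxAl !dotDl !dotDr !dotZl !dotZr -/lam y1.
  rewrite [dot (g *m A) y]dotC -(dot_sym y g symA) yg [dot g y]dotC /K.
  by rewrite expr2; lra.
have [->//|g0] := eqVneq (dot g g) 0.
have gt0 : 0 < dot g g by rewrite lt_def g0 dot_ge0.
have [K00|KN0] := eqVneq K 0; first by have := key 1; rewrite K00; lra.
have Kgt0 : 0 < K by rewrite lt_def KN0.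
pose r := dot g g / K.
have r0 : 0 < r by rewrite divr_gt0.
have gE : dot g g = r * K by rewrite /r divfK.
by have := key r; rewrite gE; nra.
Qed.

(** Replacing the entries of [y] by their absolute values keeps the norm and, as
[A] is nonnegative, does not decrease the form in absolute value. This is the
part of the Perron-Frobenius theorem that is needed: the smallest eigenvalue
cannot exceed the largest one in absolute value. *)
Lemma quadratic_abs (R : realFieldType) n (A : 'M[R]_n) (lam : R)
    (y : 'rV[R]_n) :
  (forall i j, 0 <= A i j) ->
  (forall z, dot (z *m A) z <= lam * dot z z) ->
  `|dot (y *m A) y| <= lam * dot y y.
Proof.
move=> A0 max_lam; pose z : 'rV[R]_n := \row_i `|y 0 i|.
have -> : dot y y = dot z z.
  rewrite !dotE; apply: eq_bigr => i _.
  by rewrite mxE -expr2 -[RHS]expr2 real_normK ?num_real.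
apply: le_trans (max_lam z).
rewrite !dotE; apply: le_trans (ler_norm_sum _ _ _) _.
apply: ler_sum => i _; rewrite normrM mxE [X in _ <= _ * X]mxE.
rewrite ler_wpM2r //; apply: le_trans (ler_norm_sum _ _ _) _.
rewrite mxE; apply: ler_sum => j _; rewrite normrM mxE.
by rewrite ler_wpM2l // ger0_norm.
Qed.

(** The largest eigenvalue [lam] is the operator norm. For [z = xA], the form
takes values at [x + sz] and [x - sz] that differ by [4s |z|^2]; both are
bounded by [lam] times the squared norm, and [s = 1 / lam] is the best choice. *)
Lemma eigenvalue_dominates (R : realType) n (A : 'M[R]_n) :
  (0 < n)%N -> A^T = A -> (forall i j, 0 <= A i j) ->
  exists lam : R, [/\ 0 <= lam, eigenvalue A lam &
    forall x, dot (x *m A) (x *m A) <= lam ^+ 2 * dot x x].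
Proof.
move=> n0 symA A0; have [y y1 ymax] := quadratic_max A n0.
exists (dot (y *m A) y); set lam := dot _ _ in ymax *.
have lam_abs z := quadratic_abs z A0 ymax.
have lam0 : 0 <= lam by rewrite -[lam]mulr1 -y1 (le_trans _ (lam_abs y)).
split=> // [|x].
  apply/eigenvalueP; exists y; first exact: quadratic_max_eigen.
  apply: contra_eq_neq y1 => ->.
  by rewrite /dot mul0mx mxE eq_sym oner_eq0.
set z := x *m A.
have key s : 2 * s * dot z z <= lam * (dot x x + s ^+ 2 * dot z z).
  have := ler_normlW (lam_abs (x + s *: z)).
  have : - dot ((x - s *: z) *m A) (x - s *: z)
           <= lam * dot (x - s *: z) (x - s *: z).
    by apply: ler_normlW; rewrite normrN.
  rewrite -scaleNr !mulmxDl -!scalemxAl !dotDl !dotDr !dotZl !dotZr -/z.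
  by rewrite [dot (z *m A) x](dot_sym _ _ symA) -/z [dot z x]dotC; lra.
have [lam00|lamN0] := eqVneq lam 0.
  have := key 1; rewrite lam00; have := dot_ge0 z.
  by rewrite expr0n /= !mul0r; lra.
have lamgt0 : 0 < lam by rewrite lt_def lamN0.
rewrite -subr_ge0; have -> : lam ^+ 2 * dot x x - dot z z =
    lam * (lam * (dot x x + lam^-1 ^+ 2 * dot z z) - 2 * lam^-1 * dot z z).
  by field.
by rewrite mulr_ge0 // subr_ge0.
Qed.

(** An entry of the eigenvector that is largest relative to the weight [w]
determines the size of the eigenvalue. Constant weights give the maximal row
sum; other weights give sharper bounds on irregular graphs. *)
Lemma eigenvalue_weight_bound (R : realFieldType) n (A : 'M[R]_n)
    (w : 'I_n -> R) (c a : R) :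
  (forall i j, 0 <= A i j) -> (forall i, 0 < w i) ->
  (forall i, \sum_j w j * A j i <= c * w i) ->
  eigenvalue A a -> a <= c.
Proof.
move=> A0 w0 Aw /eigenvalueP[v vA v0].
have [i0 vi0] : exists i, v 0 i != 0.
  apply/existsP; apply: contraNT v0 => /existsPn v0.
  by apply/eqP/rowP => i; rewrite mxE; have /negPn/eqP := v0 i.
pose f i := `|v 0 i| / w i.
have [i _ imax'] := @arg_maxP _ _ _ i0 xpredT f isT.
have imax j : f j <= f i by exact: imax'.
have fi0 : 0 < f i.
  by apply: lt_le_trans (imax i0); rewrite divr_gt0 // normr_gt0.
have absv j : `|v 0 j| <= f i * w j by rewrite -ler_pdivrMr // imax.
have viE : `|v 0 i| = f i * w i by rewrite divfK // gt_eqF.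
apply: le_trans (ler_norm a) _.
rewrite -(@ler_pM2r _ `|v 0 i|); last by rewrite viE mulr_gt0.
have -> : `|a| * `|v 0 i| = `|(v *m A) 0 i| by rewrite vA mxE normrM.
rewrite mxE; apply: le_trans (ler_norm_sum _ _ _) _.
apply: (@le_trans _ _ (f i * \sum_j w j * A j i)).
  rewrite mulr_sumr; apply: ler_sum => j _.
  by rewrite normrM (ger0_norm (A0 _ _)) mulrA ler_wpM2r.
by rewrite viE mulrCA ler_wpM2l // ltW.
Qed.

(** * Spectral radius of a graph *)

Lemma sum_vertices (R : nmodType) (G : sgraph) (F : G -> R) :
  \sum_(i < #|G|) F (enum_val i) = \sum_v F v.
Proof. by rewrite [RHS](reindex _ (onW_bij _ (@enum_val_bij G))). Qed.

Lemma adjacency_mx_ge0 (R : numDomainType) (G : sgraph) i j :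
  0 <= adjacency_mx R G i j.
Proof. by rewrite mxE ler0n. Qed.

Lemma adjacency_mx_sym (R : pzSemiRingType) (G : sgraph) :
  (adjacency_mx R G)^T = adjacency_mx R G.
Proof. by apply/matrixP => i j; rewrite !mxE edge_sym. Qed.

Lemma eigenvalue_vertex_weight_bound (R : realType) (G : sgraph)
    (w : G -> R) (c a : R) :
  (forall v, 0 < w v) -> (forall v, \sum_u w u * (edge u v)%:R <= c * w v) ->
  eigenvalue (adjacency_mx R G) a -> a <= c.
Proof.
move=> w0 wc; apply: (eigenvalue_weight_bound (w := fun i => w (enum_val i))).
- exact: adjacency_mx_ge0.
- by move=> i; exact: w0.
- move=> i; apply: le_trans (wc (enum_val i)); rewrite -sum_vertices.
  by apply: ler_sum => j _; rewrite mxE.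
Qed.

Lemma eigenvalue_le_spectral_radius (R : realType) (G : sgraph) (a : R) :
  eigenvalue (adjacency_mx R G) a -> a <= spectral_radius R G.
Proof.
move=> Aa; apply: ub_le_sup => //; exists #|G|%:R => b /=.
apply: (eigenvalue_vertex_weight_bound (w := fun=> 1)) => // v.
rewrite mulr1 -sum1_card natr_sum; apply: ler_sum => u _.
by rewrite mul1r ler_nat leq_b1.
Qed.

Lemma spectral_radius_norm (R : realType) (G : sgraph) : (0 < #|G|)%N ->
  0 <= spectral_radius R G /\
  forall x, dot (x *m adjacency_mx R G) (x *m adjacency_mx R G)
              <= spectral_radius R G ^+ 2 * dot x x.
Proof.
move=> G0.
have [lam [lam0 Alam Hlam]] := eigenvalue_dominates G0
  (adjacency_mx_sym R G) (@adjacency_mx_ge0 R G).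
have lam_le := eigenvalue_le_spectral_radius Alam.
split=> [|x]; first exact: le_trans lam_le.
apply: le_trans (Hlam x) _; rewrite ler_wpM2r ?dot_ge0 //.
by rewrite ler_pXn2r // nnegrE // (le_trans lam0).
Qed.

Lemma spectral_radius_le (R : realType) (G : sgraph) (w : G -> R) (c : R) :
  (0 < #|G|)%N -> (forall v, 0 < w v) ->
  (forall v, \sum_u w u * (edge u v)%:R <= c * w v) ->
  spectral_radius R G <= c.
Proof.
move=> G0 w0 wc; have [lam [_ Alam _]] := eigenvalue_dominates G0
  (adjacency_mx_sym R G) (@adjacency_mx_ge0 R G).
apply: ge_sup; first by exists lam.
by move=> a /=; exact: eigenvalue_vertex_weight_bound.
Qed.

(** The bound on the operator norm, tested on the indicator vector of [S]. *)
Lemma spectral_radius_degrees (R : realType) (G : sgraph) (S : {set G}) :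
  (0 < #|G|)%N ->
  (\sum_v (\sum_(u in S) edge u v) ^ 2)%N%:R
    <= spectral_radius R G ^+ 2 * #|S|%:R.
Proof.
move=> /(spectral_radius_norm R)[_ normA].
pose x : 'rV[R]_#|G| := \row_i (enum_val i \in S)%:R.
have xE i : x 0 i = (enum_val i \in S)%:R by rewrite /x mxE.
have xx : dot x x = #|S|%:R.
  rewrite -[#|S|]sum1_card natr_sum dotE.
  under [LHS]eq_bigr do rewrite xE.
  rewrite (sum_vertices (fun v => (v \in S)%:R * (v \in S)%:R)).
  rewrite [RHS]big_mkcond; apply: eq_bigr => v _.
  by case: (v \in S); rewrite ?mulr1 ?mulr0.
have xA j : (x *m adjacency_mx R G) 0 j
    = (\sum_(u in S) edge u (enum_val j))%N%:R.
  rewrite mxE; under [LHS]eq_bigr do rewrite xE mxE.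
  rewrite (sum_vertices (fun u => (u \in S)%:R * (edge u (enum_val j))%:R)).
  rewrite natr_sum [RHS]big_mkcond; apply: eq_bigr => u _.
  by case: (u \in S); rewrite ?mul1r ?mul0r.
have := normA x; rewrite xx dotE; apply: le_trans.
rewrite natr_sum -sum_vertices; apply: ler_sum => j _.
by rewrite xA natrX expr2.
Qed.

(** * Spanning trees, vertex covers and matchings *)

(** The parent of a vertex is a neighbour closer to the root for the graph
distance. The tree is given by its parent map; the depth [d] only records that
this map has no cycle. *)
Lemma rooted_spanning_tree (G : sgraph) : connected_graph G ->
  exists (r : G) (par : G -> G) (d : G -> nat),
    forall v, v != r -> edge (par v) v /\ (d (par v) < d v)%N.
Proof.
move=> [/card_gt0P[r _] conn]; exists r.
pose P x n := [exists p : n.-tuple G, path (@edge G) r p && (last r p == x)].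
have exP x : exists n, P x n.
  have /connectP[p rp xE] := conn r x.
  by exists (size p); apply/existsP; exists (in_tuple p); rewrite rp xE /=.
pose d x := ex_minn (exP x).
exists (fun v => odflt v [pick u | edge u v && (d u < d v)%N]), d => v vr.
case: pickP => [u /andP[] //|] nopar; exfalso.
have : exists2 u, edge u v & (d u < d v)%N.
  rewrite {2}/d; case: ex_minnP => n /existsP[p /andP[rp /eqP pv]] _.
  case: n p rp pv => [|n] p.
    by rewrite tuple0 /= => _ /eqP; rewrite eq_sym (negPf vr).
  case: (tupleP p) => a q.
  rewrite -[tval _]/(a :: val q) lastI rcons_path last_rcons.
  move=> /andP[rp +] vE; rewrite vE => uv; exists (last r (belast a q)) => //.
  rewrite /d; case: ex_minnP => k _ /(_ n); rewrite ltnS; apply.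
  have sz : size (belast a q) == n by rewrite size_belast size_tuple.
  by apply/existsP; exists (Tuple sz); rewrite /= rp eqxx.
by move=> [u uv du]; have := nopar u; rewrite uv du.
Qed.

(** The recursion that decides membership in [S] is well founded because [d]
increases along [e] and is bounded: iterating it from the empty set fixes the
vertices of largest [d] first, and everything after boundedly many steps. *)
Lemma dag_kernel (T : finType) (e : rel T) (d : T -> nat) :
  (forall v c, e v c -> (d v < d c)%N) ->
  exists S : {set T}, forall v, (v \in S) = [exists c, e v c && (c \notin S)].
Proof.
move=> de; pose F (S : {set T}) :=
  [set v | [exists c, e v c && (c \notin S)]]%SET.
pose N := (\max_x d x)%N.
have dN v : (d v <= N)%N by exact: leq_bigmax.
have stable m v : (N < m + d v)%N ->
    (v \in iter m.+1 F finset.set0) = (v \in iter m F finset.set0).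
  elim: m v => [|m IH] v Nv; first by move: (dN v); rewrite leqNgt Nv.
  rewrite [in RHS]iterS iterS !inE; apply: eq_existsb => c.
  case evc: (e v c) => //=; rewrite IH //.
  by move: (de _ _ evc) Nv; lia.
exists (iter N.+1 F finset.set0) => v.
rewrite -stable; first by rewrite iterS inE.
by rewrite addSn ltnS leq_addr.
Qed.

(** The pairs are disjoint because one end lies in [S] and the other outside,
and each end determines its pair. *)
Lemma matching_from_mates (G : sgraph) (S : {set G}) (mate : G -> G) :
  {in S, forall v, edge v (mate v)} -> {in S, forall v, mate v \notin S} ->
  {in S &, injective mate} -> (#|S| <= matching_number G)%N.
Proof.
move=> emate mateS imate.
pose M := [set [set v; mate v]%SET | v in S]%SET.
have meet u v x : u \in S -> v \in S ->
    x \in [set u; mate u]%SET -> x \in [set v; mate v]%SET -> u = v.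
  move=> uS vS; rewrite !inE => /orP[]/eqP-> /orP[]/eqP.
  - by [].
  - by move=> E; have := mateS v vS; rewrite -E uS.
  - by move=> E; have := mateS u uS; rewrite E vS.
  - exact: imate.
have cardM : #|M| = #|S|.
  apply: card_in_imset => u v uS vS E.
  by apply: (meet u v u) => //; rewrite -?E !inE eqxx.
rewrite -cardM; apply: (leq_bigmax_cond (F := fun M : {set {set G}} => #|M|)).
apply/andP; split.
  apply/fintype.subsetP => A /imsetP[v vS ->]; rewrite inE.
  apply/existsP; exists v; apply/existsP.
  by exists (mate v); rewrite emate ?eqxx.
apply/finset.trivIsetP => A B /imsetP[u uS ->] /imsetP[v vS ->].
apply: contraR => /pred0Pn[x /andP[/= xu xv]].
by rewrite (meet u v x).
Qed.

(** König's theorem for a spanning tree: [S] is the set of vertices with a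
child outside [S]. It covers the edge from [v] to its parent, since the parent
is in [S] as soon as [v] is not; and each vertex of [S] is matched with such a
child.
The second clause says that no tree edge is the parent edge of both its ends. *)
Lemma spanning_tree_cover (G : sgraph) : connected_graph G ->
  exists (r : G) (par : G -> G) (S : {set G}),
    [/\ forall v, v != r -> edge (par v) v,
        forall v, v != r -> par v != r -> par (par v) != v,
        forall v, v != r -> (v \in S) || (par v \in S) &
        (#|S| <= matching_number G)%N].
Proof.
move=> /rooted_spanning_tree[r [par [d tree]]].
pose child v c := (c != r) && (par c == v).
have [S SE] : exists S : {set G},
    forall v, (v \in S) = [exists c, child v c && (c \notin S)].
  by apply: (dag_kernel (d := d)) => v c /andP[cr /eqP <-]; case: (tree c cr).
exists r, par, S; split.
- by move=> v /tree[].
- move=> v vr pvr; have [_ dv] := tree v vr; have [_ dpv] := tree _ pvr.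
  by apply: contraTneq dpv => ->; rewrite -leqNgt ltnW.
- move=> v vr; case vS: (v \in S) => //=; rewrite SE.
  by apply/existsP; exists v; rewrite /child vr eqxx vS.
pose mate v := odflt v [pick c | child v c && (c \notin S)].
have mateP v : v \in S -> child v (mate v) && (mate v \notin S).
  by rewrite SE /mate; case: pickP => //= noc /existsP[c]; rewrite noc.
apply: (matching_from_mates (mate := mate)).
- move=> v /mateP/andP[/andP[mr /eqP pm] _].
  by have [+ _] := tree _ mr; rewrite pm.
- by move=> v /mateP/andP[].
- move=> u v /mateP/andP[/andP[_ /eqP pu] _] /mateP/andP[/andP[_ /eqP pv] _].
  by move=> E; rewrite -pu -pv E.
Qed.

(** Give weight 1 to the vertices of [S] and 2 to the others. A tree edge inside
[S] adds 1 to the weighted degree sum at each end; an edge leaving [S] is seen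
only from its outer end and adds 2 there. The n - 1 tree edges thus contribute
2(n - 1), and [wt v * deg v <= deg v ^ 2 + (v \notin S)] for all [v]. *)
Lemma degrees_into_tree_cover (G : sgraph) (r : G) (par : G -> G)
    (S : {set G}) :
  (forall v, v != r -> edge (par v) v) ->
  (forall v, v != r -> par v != r -> par (par v) != v) ->
  (forall v, v != r -> (v \in S) || (par v \in S)) ->
  (#|G| + #|S| <= \sum_v (\sum_(u in S) edge u v) ^ 2 + 2)%N.
Proof.
move=> tree acyc cover.
pose wt v := if v \in S then 1%N else 2%N.
pose deg v := (\sum_(u in S) edge u v)%N.
have point v : (wt v * deg v <= deg v ^ 2 + (v \notin S))%N.
  by rewrite /wt; case: (v \in S) => /=; nia.
have total : (2 * #|G|.-1 <= \sum_v wt v * deg v)%N.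
  pose up v u := (v != r) && (u == par v).
  (* A neighbour of [v] in the tree is its parent or a child, never both. *)
  have degE v : (\sum_u (u \in S) * (up v u + up u v) <= deg v)%N.
    rewrite /deg [leqRHS]big_mkcond; apply: leq_sum => u _.
    case: (u \in S) => //; rewrite mul1n /up.
    case: (eqVneq v r) => [->|vr] /=.
      case: (eqVneq u r) => //= ur; case: eqP => //= ->.
      by rewrite edge_sym tree.
    case: (eqVneq u (par v)) => [->|_] /=.
      rewrite tree //; case: (eqVneq (par v) r) => //= pvr.
      by rewrite eq_sym (negPf (acyc v vr pvr)).
    by case: (eqVneq u r) => //= ur; case: eqP => //= ->; rewrite edge_sym tree.
  apply: (@leq_trans (\sum_(v | v != r)
    (wt v * (par v \in S) + wt (par v) * (v \in S)))).
    rewrite -[#|G|.-1]/(predn _) -(cardC1 r) -sum1_card big_distrr /=.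
    apply: leq_sum => v /cover; rewrite /wt.
    by case: (v \in S); case: (par v \in S).
  rewrite big_split /=.
  apply: (@leq_trans (\sum_v wt v *
    \sum_u (u \in S) * (up v u + up u v))); last first.
    by apply: leq_sum => v _; rewrite leq_mul2l degE orbT.
  under [leqRHS]eq_bigr => v _.
    under eq_bigr => u _ do rewrite mulnDr.
    rewrite big_split mulnDr /=; over.
  rewrite big_split /= leq_add //.
    rewrite big_mkcond; apply: leq_sum => v _; case: ifP => // vr.
    by rewrite (bigD1 (par v)) //= /up vr eqxx muln1 mulnDr leq_addr.
  under [leqRHS]eq_bigr do rewrite big_distrr /=.
  rewrite exchange_big /= big_mkcond; apply: leq_sum => u _; case: ifP => // ur.
  by rewrite (bigD1 (par u)) //= /up ur eqxx muln1 leq_addr.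
have : (\sum_v wt v * deg v <= \sum_v deg v ^ 2 + (#|G| - #|S|))%N.
  apply: (@leq_trans (\sum_v (deg v ^ 2 + (v \notin S)))); first exact: leq_sum.
  rewrite big_split /= leq_add2l.
  have -> : (#|G| - #|S| = #|~: S|)%N by rewrite -(cardsC S) addKn.
  rewrite -sum1_card [leqRHS]big_mkcond /=; apply: leq_sum => v _.
  by rewrite inE; case: (v \in S).
rewrite -[(\sum_v (\sum_(u in S) edge u v) ^ 2)%N]/(\sum_v deg v ^ 2)%N.
have : (#|S| <= #|G|)%N by exact: max_card.
have : (0 < #|G|)%N by apply/card_gt0P; exists r.
lia.
Qed.

(** Here [s] is the size of the cover of a spanning tree. It is at
least 1 because a connected graph with two vertices has an edge. *)
Lemma spectral_radius_matching (R : realType) (G : sgraph) :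
  connected_graph G -> (1 < #|G|)%N ->
  exists s, [/\ (0 < s)%N, (s <= matching_number G)%N &
    (#|G| + s)%:R <= spectral_radius R G ^+ 2 * s%:R + 2].
Proof.
move=> connG G1.
have [r [par [S [tree acyc cover Sle]]]] := spanning_tree_cover connG.
exists #|S|; split=> //.
  have /card_gt0P[v] : (0 < #|predC1 r|)%N by rewrite cardC1 -subn1 subn_gt0.
  rewrite inE => vr.
  by apply/card_gt0P; case/orP: (cover v vr) => vS; [exists v|exists (par v)].
apply: le_trans (_ : (\sum_v (\sum_(u in S) edge u v) ^ 2 + 2)%N%:R <= _).
  by rewrite ler_nat (degrees_into_tree_cover tree acyc cover).
by rewrite natrD lerD2r spectral_radius_degrees // ltnW.
Qed.

(** Every edge of a matching meets the cover, and a vertex of the cover meets at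
most one of them; so double counting incidences suffices. *)
Lemma matching_number_le_cover (G : sgraph) (C : {set G}) :
  (forall x y, edge x y -> (x \in C) || (y \in C)) ->
  (matching_number G <= #|C|)%N.
Proof.
move=> cover; apply/bigmax_leqP => M.
move=> /andP[/fintype.subsetP ME /finset.trivIsetP MT].
apply: (@leq_trans (\sum_(e in M) \sum_(x in C) (x \in e))).
  rewrite -sum1_card; apply: leq_sum => e /ME.
  rewrite inE => /existsP[x /existsP[y /andP[xy /eqP ->]]].
  by case/orP: (cover x y xy) => zC; rewrite (bigD1 _ zC) /= !inE eqxx ?orbT.
rewrite exchange_big -[leqRHS]sum1_card; apply: leq_sum => x _.
rewrite -big_mkcondr sum1_card; apply/card_le1_eqP => A B.
move=> /andP[AM xA] /andP[BM xB]; apply/eqP; apply: contraT.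
by move=> BA; rewrite (disjointFr (MT _ _ BM AM BA) xB) in xA.
Qed.

(** * Stars whose centres form a clique *)

(** A vertex [(i, b)] lies in the [i]-th star, whose centre is the vertex with
[b = (0, 0)]; a second component in a set of size M^2 makes the order M^3. *)
Definition star_clique_vertex (m : nat) : finType :=
  ('I_m.+1 * ('I_m.+1 * 'I_m.+1))%type.

Definition hub (m : nat) (x : star_clique_vertex m) := x.2 == (ord0, ord0).

Definition star_clique_edge (m : nat) (x y : star_clique_vertex m) :=
  (x != y) && (hub x && hub y || (x.1 == y.1) && (hub x || hub y)).

Lemma star_clique_edge_sym (m : nat) : symmetric (@star_clique_edge m).
Proof.
move=> x y; rewrite /star_clique_edge eq_sym [hub x && _]andbC.
by rewrite [x.1 == _]eq_sym [hub x || _]orbC.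
Qed.

Lemma star_clique_edge_irrefl (m : nat) : irreflexive (@star_clique_edge m).
Proof. by move=> x; rewrite /star_clique_edge eqxx. Qed.

Definition star_clique (m : nat) :=
  SGraph (@star_clique_edge_sym m) (@star_clique_edge_irrefl m).

Lemma card_star_clique (m : nat) : #|star_clique m| = (m.+1 ^ 3)%N.
Proof. by rewrite /= !card_prod !card_ord; lia. Qed.

Lemma card_hubs (m : nat) :
  #|[set x : star_clique_vertex m | hub x]%SET| = m.+1.
Proof.
rewrite (_ : finset.finset _ =
    finset.setX [set: 'I_m.+1]%SET [set (ord0, ord0)]%SET).
  by rewrite cardsX cardsT card_ord cards1 muln1.
by apply/finset.setP => -[a b]; rewrite !inE.
Qed.

Lemma card_star_block (m : nat) (i : 'I_m.+1) :
  #|[set x : star_clique_vertex m | x.1 == i]%SET| = (m.+1 ^ 2)%N.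
Proof.
rewrite (_ : finset.finset _ =
    finset.setX [set i]%SET [set: 'I_m.+1 * 'I_m.+1]%SET).
  by rewrite cardsX cardsT card_prod card_ord cards1 mul1n.
by apply/finset.setP => -[a b]; rewrite !inE andbT.
Qed.

Lemma connected_star_clique (m : nat) : connected_graph (star_clique m).
Proof.
split; first by rewrite card_star_clique expn_gt0.
pose o : 'I_m.+1 * 'I_m.+1 := (ord0, ord0).
have csym := sym_connect_sym (@star_clique_edge_sym m).
suff to_root x : connect (@star_clique_edge m) x (ord0, o).
  by move=> x y; rewrite (connect_trans (to_root x)) // csym to_root.
have edge_connect u v : (u != v -> star_clique_edge u v) ->
    connect (@star_clique_edge m) u v.
  by case: (eqVneq u v) => [-> _|_ /(_ isT)]; [exact: connect0|exact: connect1].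
apply: (@connect_trans _ _ (x.1, o)); apply: edge_connect => ne.
  by rewrite /star_clique_edge ne /hub /= !eqxx !orbT.
by rewrite /star_clique_edge ne.
Qed.

Lemma matching_star_clique (m : nat) :
  (matching_number (star_clique m) <= m.+1)%N.
Proof.
rewrite -[leqRHS](card_hubs m); apply: matching_number_le_cover => x y.
by rewrite !inE => /andP[_ /orP[/andP[->]|/andP[_]]].
Qed.

(** Weights M on centres and 1 on leaves, with M = m + 1. The neighbours of a
centre weigh less than M * M (centres) plus M^2 (its own star), that is 2M
times its weight; a leaf has only its centre as neighbour, of weight M. *)
Lemma spectral_radius_star_clique (R : realType) (m : nat) :
  spectral_radius R (star_clique m) <= 2 * m.+1%:R.
Proof.
pose w (x : star_clique m) : R := if hub x then m.+1%:R else 1.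
have w1 x : 1 <= w x by rewrite /w; case: ifP => //; rewrite ler1n.
apply: (spectral_radius_le (w := w)) => [|v|v].
- by rewrite card_star_clique expn_gt0.
- exact: lt_le_trans (w1 v).
case hv : (hub v); last first.
  have bound u : w u * (edge u v)%:R <= (u == (v.1, (ord0, ord0)))%:R * m.+1%:R.
    rewrite /edge /= /star_clique_edge hv andbF orbF /w /hub.
    case: (eqVneq u.2) => [u2|_]; last by rewrite /= !andbF mulr0 mulr_ge0.
    case: (eqVneq u.1 v.1) => [u1|_]; last by rewrite /= andbF mulr0 mulr_ge0.
    have -> : u = (v.1, (ord0, ord0)) by rewrite [LHS]surjective_pairing u1 u2.
    rewrite eqxx mul1r ler_piMr //.
    by rewrite lern1 leq_b1.
  apply: le_trans (ler_sum _ (fun u _ => bound u)) _.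
  rewrite -mulr_suml (bigD1 (v.1, (ord0, ord0))) //= big1 => [|u /negPf->//].
  by rewrite eqxx addr0 mul1r {1}/w hv mulr1 ler_peMl // ler1n.
have bound u : w u * (edge u v)%:R <=
    (u \in [set x : star_clique_vertex m | hub x]%SET)%:R * m.+1%:R
    + (u \in [set x : star_clique_vertex m | x.1 == v.1]%SET)%:R.
  rewrite !inE /edge /= /star_clique_edge hv andbT orbT andbT /w.
  case: (hub u) => /=.
    rewrite mul1r andbT; apply: ler_wpDr => //.
    by rewrite ler_piMr // lern1 leq_b1.
  rewrite mul1r mul0r add0r ler_nat.
  by case: (u.1 == v.1); rewrite ?andbF ?leq_b1.
apply: le_trans (ler_sum _ (fun u _ => bound u)) _.
have sum_mem (A : {set star_clique_vertex m}) :
    \sum_(u : star_clique_vertex m) (u \in A)%:R = #|A|%:R :> R.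
  rewrite -sum1_card natr_sum [RHS]big_mkcond.
  by apply: eq_bigr => u _; case: ifP.
rewrite big_split -mulr_suml /= !sum_mem card_hubs card_star_block /w hv.
by rewrite natrX expr2; lra.
Qed.

(** * The cube root bound *)

Lemma cube_powR_inv3 (R : realType) (x : R) : 0 <= x -> (x `^ 3^-1) ^+ 3 = x.
Proof.
by move=> x0; rewrite -powR_mulrn ?powR_ge0 // -powRrM mulVf ?powRr1.
Qed.

Lemma powR_inv3_cube (R : realType) (x : R) : 0 <= x -> (x ^+ 3) `^ 3^-1 = x.
Proof.
by move=> x0; rewrite -powR_mulrn // -powRrM divff ?powRr1.
Qed.

(** The arithmetic-geometric mean inequality for a/2, a/2, b. The factorisation
[(a + b)^3 - 27/4 a^2 b = (a - 2b)^2 (a + b/4)] also shows that equality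
requires [a = 2b]. *)
Lemma amgm_cube (R : realFieldType) (a b y : R) : 0 <= a -> 0 <= b -> 0 <= y ->
  4 * y ^+ 3 <= a ^+ 2 * b -> 3 * y <= a + b.
Proof.
move=> a0 b0 y0 H; rewrite -(@ler_pXn2r _ 3) ?nnegrE ?addr_ge0 ?mulr_ge0 //.
have : 0 <= (a - 2 * b) ^+ 2 * (a + b / 4).
  by rewrite mulr_ge0 ?sqr_ge0 ?addr_ge0 ?divr_ge0.
move: H; have -> : (a - 2 * b) ^+ 2 * (a + b / 4)
  = (a + b) ^+ 3 - 27 / 4 * (a ^+ 2 * b) by field.
have -> : (3 * y) ^+ 3 = 27 / 4 * (4 * y ^+ 3) by field.
lra.
Qed.

(** With [y^3 = n/4] the claim is [3y <= rho + k]. For k = 1 it reduces to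
[(3y - 1)^2 <= 4y^3 - 1], which holds from [y = 5/3] on, and [n >= 20] gives
[y^3 >= 5 > (5/3)^3]. *)
Lemma spectral_radius_matching_bound (R : realType) (G : sgraph) :
  connected_graph G ->
  (1 < matching_number G)%N || (19 < #|G|)%N ->
  3 * (#|G|%:R / 4) `^ 3^-1 <= spectral_radius R G + (matching_number G)%:R.
Proof.
move=> connG large.
have kn : (matching_number G <= #|G|)%N.
  rewrite -cardsT; apply: matching_number_le_cover => x y _.
  by rewrite inE.
have n1 : (1 < #|G|)%N by case/orP: large => H; lia.
have [rho0 _] := spectral_radius_norm R (ltnW n1).
have [s [s0 sk]] := spectral_radius_matching R connG n1.
set rho := spectral_radius R G in rho0 *.
set n := #|G| in kn n1 large *; set k := matching_number G in kn sk large *.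
set y := (n%:R / 4) `^ 3^-1.
have y0 : 0 <= y by exact: powR_ge0.
have y3 : 4 * y ^+ 3 = n%:R.
  by rewrite cube_powR_inv3 ?divr_ge0 // mulrC divfK.
move=> main; have [k2|k1] := leqP 2 k.
  apply: amgm_cube => //; rewrite y3.
  have sq0 : 0 <= rho ^+ 2 by exact: sqr_ge0.
  (* If s = 1 then rho^2 >= n - 1 >= n / 2; otherwise rho^2 s >= n directly. *)
  case: s s0 sk main => [//|[|s]] _ sk main.
    have : rho ^+ 2 * 2 <= rho ^+ 2 * k%:R by rewrite ler_wpM2l // ler_nat.
    have : (2 : R) <= n%:R by rewrite ler_nat.
    by move: main; rewrite natrD; lra.
  have : rho ^+ 2 * s.+2%:R <= rho ^+ 2 * k%:R by rewrite ler_wpM2l // ler_nat.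
  have : (0 : R) <= s%:R by [].
  by move: main; rewrite -[s.+2]addn2 !natrD; lra.
have n20 : (20 : R) <= n%:R by rewrite ler_nat; case/orP: large; lia.
have -> : k = 1%N by lia.
have s1 : s = 1%N by lia.
move: main; rewrite s1 natrD => main.
have y53 : 5 / 3 <= y.
  rewrite -(@ler_pXn2r _ 3) ?nnegrE ?divr_ge0 //.
  by rewrite expr_div_n -!natrX; lra.
have : (3 * y - 1) ^+ 2 <= rho ^+ 2.
  by move: main; rewrite -y3 !exprS expr0; nra.
by rewrite ler_pXn2r ?nnegrE //; lra.
Qed.

Theorem corollary5 (R : realType) :
  (forall (G : sgraph) (n k : nat),
     connected_graph G -> #|G| = n -> matching_number G = k ->
     (2 <= k)%N \/ (k = 1%N /\ (20 <= n)%N) ->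
     spectral_radius R G + k%:R >= 3 * (n%:R / 4) `^ (3^-1))
  /\
  (exists (C : R) (G : nat -> sgraph),
     [/\ 0 < C,
         forall m : nat, connected_graph (G m),
         #|G m| @[m --> \oo] --> \oo,
         forall m : nat,
           spectral_radius R (G m) + (matching_number (G m))%:R
             <= C * (#|G m|%:R : R) `^ (3^-1) &
         ((fun m => spectral_radius R (G m) + (matching_number (G m))%:R)
            : nat -> R^o)
           \is 'Theta_\oo ((fun m => (#|G m|%:R : R) `^ (3^-1)) : nat -> R^o)]).
Proof.
split=> [G n k connG <- <- large|].
  apply: spectral_radius_matching_bound => //.
  by case: large => [->//|[_ ->]]; rewrite orbT.
have cbrt_card m : (#|star_clique m|%:R : R) `^ 3^-1 = m.+1%:R.
  by rewrite card_star_clique natrX powR_inv3_cube.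
have upper m : spectral_radius R (star_clique m)
    + (matching_number (star_clique m))%:R <= 3 * m.+1%:R.
  have := spectral_radius_star_clique R m.
  have : ((matching_number (star_clique m))%:R : R) <= m.+1%:R.
    by rewrite ler_nat matching_star_clique.
  lra.
exists 3, star_clique; split=> //.
- exact: connected_star_clique.
- apply/cvgnyPge => A; exists A => // m /= Am.
  rewrite card_star_clique; apply: leq_trans Am _.
  by apply: ltnW; rewrite -[X in (X <= _)%N]expn1 leq_pexp2l.
- by move=> m; rewrite cbrt_card.
rewrite qualifE; apply/asboolP; exists (1, 3) => /=.
  by rewrite ltr01 ltr0n.
(* From M = 3 on, the order M^3 is at least 20, so the lower bound applies
   whatever the matching number is. *)
exists 2%N => // m /= m2.
have n20 : (19 < #|star_clique m|)%N.
  rewrite card_star_clique; apply: (@leq_trans (3 ^ 3)) => //.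
  by rewrite leq_exp2r.
have lower := spectral_radius_matching_bound R (connected_star_clique m).
have lower_le : (m.+1%:R : R) <= 3 * (#|star_clique m|%:R / 4) `^ 3^-1.
  have y0 : 0 <= (#|star_clique m|%:R / 4 : R) `^ 3^-1 by exact: powR_ge0.
  rewrite -(@ler_pXn2r _ 3) ?nnegrE ?mulr_ge0 // exprMn cube_powR_inv3 //.
  by rewrite card_star_clique natrX; have := exprn_ge0 3 (ler0n R m.+1); lra.
have {lower}lower := le_trans lower_le (lower _); rewrite n20 orbT in lower.
have {}lower := lower isT.
rewrite cbrt_card mul1r [`|m.+1%:R : R^o|]ger0_norm //.
by rewrite ger0_norm ?(le_trans _ lower).
Qed.
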